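(* Let $\|\cdot\|_x,\|\cdot\|_f,\|\cdot\|_s$ be norms on $\mathbb{R}^n$, let $A,B^f,B^s\in\mathbb{R}^{n\times n}$ with $B^f$ invertible, let $k\ge 1$ and let $T\ge 1$ be a multiple of $k$. Let $c>0$ be a constant such that $\|v\|_x\ge c\|v\|_f$ for all $v\in\mathbb{R}^n$. Then for every disturbance sequence $w=(w_1,\dots,w_T)$ and every sequence of predictions $\hat w=(\hat w_1,\dots,\hat w_T)$ in $\mathbb{R}^n$ (no assumption being made on the disturbances or on the prediction errors), the cost $MRPC$ of the algorithm MRPC and the offline optimal cost $OPT$ of the multi-timescale control problem satisfy $$\frac{MRPC}{T}\;\le\;\max\left(\frac{(1+\|A\|_x)\,\|(B^f)^{-1}\|}{c},\,1\right)\frac{OPT}{T}\;+\;2\,\|(B^f)^{-1}\|\,E(\hat w,w),$$ where $$E(\hat w,w)=\frac1T\sum_{t=1}^T\|\hat w_t-w_t\|_f .$$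
   Context: Multi-timescale control problem. Given $w_1,\dots,w_T\in\mathbb{R}^n$, let $\mathcal S=\{1,k+1,2k+1,\dots\}\cap\{1,\dots,T\}$ be the set of slow timesteps. The slow control action is constant, equal to $s_r\in\mathbb{R}^n$, on each block $t=r,\dots,r+k-1$ with $r\in\mathcal S$. The offline optimal cost is $$OPT=\min_{x,f,s}\ \sum_{r\in\mathcal S}\Big[k\|s_r\|_s+\sum_{t=r}^{r+k-1}\big(\|x_t\|_x+\|f_t\|_f\big)\Big]$$ subject to $x_0=0$ and $x_t=Ax_{t-1}+B^ff_t+B^ss_r+w_t$ for $r\in\mathcal S$ and $r\le t\le r+k-1$, where $x_t,f_t\in\mathbb{R}^n$ and all of $w$ is known. Algorithm MRPC (Multi-timescale Reflexive Predictive Control). At each $r\in\mathcal S$, using the predictions $\hat w_r,\dots,\hat w_{r+k-1}$, the slow controller plays $$\hat s_r\in\arg\min_{s_r\in\mathbb{R}^n}\Big[k\|s_r\|_s+\sum_{t=r}^{r+k-1}\|(B^f)^{-1}(B^ss_r+\hat w_t)\|_f\Big],$$ and for $t=r,\dots,r+k-1$, after $w_t$ is revealed, the fast controller plays $$\hat f_t=-(B^f)^{-1}(B^s\hat s_r+w_t).$$ The state evolves by the same dynamics (so it starts at $x_0=0$), and $MRPC$ denotes the value of the objective above under these actions. Norm conventions: $\|A\|_x$ is the matrix norm of $A$ induced by $\|\cdot\|_x$, and $\|(B^f)^{-1}\|$ is the matrix norm of $(B^f)^{-1}$ induced by $\|\cdot\|_f$. *)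

(* Defs.v *)
From HB Require Import structures.
From mathcomp Require Import all_boot all_order all_algebra.
From mathcomp Require Import all_classical all_reals.

Set Implicit Arguments.
Unset Strict Implicit.
Unset Printing Implicit Defensive.

Import Order.TTheory GRing.Theory Num.Theory.

Local Open Scope classical_set_scope.
Local Open Scope ring_scope.

(* The three norms live on the same space R^n, so a norm is a predicate on
   functions rather than a canonical structure on the carrier.  Nonnegativity
   follows from the three axioms. *)
Record is_norm (R : realType) (n : nat) (N : 'cV[R]_n -> R) : Prop := IsNorm {
  norm_triangle : forall u v, N (u + v) <= N u + N v;
  norm_homogeneous : forall a v, N (a *: v) = `|a| * N v;
  norm_definite : forall v, N v = 0 -> v = 0
}.

Definition induced_norm (R : realType) (n : nat) (N : 'cV[R]_n -> R)
    (M : 'M[R]_n) : R :=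
  sup [set N (M *m v) | v in [set v | N v <= 1]].

(* Sequences over the timesteps 1, ..., T (x_0 included for the state) are
   functions on nat.  When k divides T, nothing below reads an entry of w, w',
   f or s outside {1, ..., T}, or of x outside {0, ..., T}. *)

Definition slow (k T r : nat) : bool :=
  (1 <= r <= T)%N && (r == 1 %[mod k])%N.

Definition feasible (R : realType) (n : nat) (A Bf Bs : 'M[R]_n) (k T : nat)
    (w x f s : nat -> 'cV[R]_n) : Prop :=
  x 0%N = 0 /\
  forall r t : nat, slow k T r -> (r <= t < r + k)%N ->
    x t = A *m x t.-1 + Bf *m f t + Bs *m s r + w t.

Definition cost (R : realType) (n : nat) (Nx Nf Ns : 'cV[R]_n -> R)
    (k T : nat) (x f s : nat -> 'cV[R]_n) : R :=
  \sum_(1 <= r < T.+1 | slow k T r)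
    (k%:R * Ns (s r) + \sum_(r <= t < r + k) (Nx (x t) + Nf (f t))).

(* The costs form a nonempty set of nonnegative reals, so this infimum is a
   genuine one; it is attained, the cost being a continuous coercive function
   of the actions and of the state. *)
Definition OPT (R : realType) (n : nat) (Nx Nf Ns : 'cV[R]_n -> R)
    (A Bf Bs : 'M[R]_n) (k T : nat) (w : nat -> 'cV[R]_n) : R :=
  inf [set y : R | exists x f s : nat -> 'cV[R]_n,
         feasible A Bf Bs k T w x f s /\ y = cost Nx Nf Ns k T x f s].

Definition slow_objective (R : realType) (n : nat) (Nf Ns : 'cV[R]_n -> R)
    (Bf Bs : 'M[R]_n) (k : nat) (w' : nat -> 'cV[R]_n) (r : nat)
    (v : 'cV[R]_n) : R :=
  k%:R * Ns v + \sum_(r <= t < r + k) Nf (invmx Bf *m (Bs *m v + w' t)).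

(* (x, f, s) is an execution of MRPC on the disturbances w with predictions w'.
   The slow action may be any minimizer: ties are broken arbitrarily. *)
Definition MRPC_run (R : realType) (n : nat) (Nf Ns : 'cV[R]_n -> R)
    (A Bf Bs : 'M[R]_n) (k T : nat) (w w' x f s : nat -> 'cV[R]_n) : Prop :=
  [/\ forall r, slow k T r -> forall v,
        slow_objective Nf Ns Bf Bs k w' r (s r)
          <= slow_objective Nf Ns Bf Bs k w' r v,
      forall r t, slow k T r -> (r <= t < r + k)%N ->
        f t = - (invmx Bf *m (Bs *m s r + w t))
    & feasible A Bf Bs k T w x f s].

Definition prediction_error (R : realType) (n : nat) (Nf : 'cV[R]_n -> R)
    (T : nat) (w' w : nat -> 'cV[R]_n) : R :=
  T%:R^-1 * \sum_(1 <= t < T.+1) Nf (w' t - w t).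

(* Main.v *)
Require Import Defs.
From mathcomp Require Import all_boot all_order all_algebra.
From mathcomp Require Import all_classical all_reals.
From mathcomp Require Import all_analysis.
From mathcomp Require Import ring lra zify.
Import Order.TTheory GRing.Theory Num.Theory.
Import numFieldNormedType.Exports.
Local Open Scope ring_scope.

(** Since [f t] cancels [Bs *m s r + w t] exactly, the algorithm keeps the state
    at 0, and its cost is the sum over the blocks of the slow objective evaluated
    at the true disturbances ([MRPC_cost]).  It remains to compare this sum with
    the cost of an arbitrary feasible trajectory [(y, g, u)]; write [a] for the
    induced norm of [A] and [b] for that of [invmx Bf].

    Prediction errors.  Replacing [w'] by [w] changes the slow objective of a
    block by at most [b] times the prediction error on that block
    ([slow_objective_lipschitz]).  The action played minimizes the objective for
    [w'], so passing from [w] to [w'] and back shows that it is optimal for [w] up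
    to twice that amount ([slow_regret]).

    Reflexive control against an arbitrary trajectory.  The dynamics give
    [invmx Bf *m (Bs *m u r + w t) = invmx Bf *m (y t - A *m y t.-1) - g t], whence
    [Nf (invmx Bf *m (Bs *m u r + w t)) <= Nf (g t) + b / c * (Nx (y t) + a * Nx (y t.-1))].
    Summed over time, the two state terms merge into
    [(1 + a) * b / c * \sum_t Nx (y t)] because [y 0 = 0], and this is dominated
    by the state cost of the trajectory ([reflexive_le_feasible]).

    Both steps use [N (M *m v) <= induced_norm N M * N v] ([le_induced_norm]).
    The induced norm is a real supremum, worth 0 on unbounded sets, so this needs
    the boundedness of [M] on the unit ball of an arbitrary norm: that is the
    equivalence of norms in finite dimension, here comparison with the sup norm
    ([seminorm_le_sup], [sup_le_norm]). *)

Set Implicit Arguments.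
Unset Strict Implicit.
Unset Printing Implicit Defensive.

(** * Norms on R^n and induced matrix norms *)

Section Norms.
Variables (R : realType) (n : nat).
Implicit Types (N g : 'cV[R]_n -> R) (u v : 'cV[R]_n) (M : 'M[R]_n).

Lemma is_norm0 N : is_norm N -> N 0 = 0.
Proof. by case=> _ hZ _; rewrite -(scale0r 0) hZ normr0 mul0r. Qed.

Lemma is_normN N v : is_norm N -> N (- v) = N v.
Proof. by case=> _ hZ _; rewrite -scaleN1r hZ normrN1 mul1r. Qed.

Lemma is_norm_ge0 N v : is_norm N -> 0 <= N v.
Proof.
move=> hN; have := norm_triangle hN v (- v).
by rewrite subrr is_norm0// is_normN//; lra.
Qed.

Lemma is_normB N u v : is_norm N -> N (u - v) <= N u + N v.
Proof. by move=> hN; rewrite -[N v](is_normN _ hN); exact: norm_triangle. Qed.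

(** Definiteness is not assumed, so that the lemma applies both to a norm [N]
    and to [fun v => N (M *m v)].  The sup norm is taken on the transpose, since
    the compactness results used below are about row vectors. *)
Lemma seminorm_le_sup g :
  (forall u v, g (u + v) <= g u + g v) ->
  (forall a v, g (a *: v) = `|a| * g v) ->
  exists K, forall v, g v <= K * `|v^T|.
Proof.
move=> gD gZ.
have g0 : g 0 = 0 by rewrite -(scale0r 0) gZ normr0 mul0r.
have ge0 v : 0 <= g v.
  have := gD v (- v); rewrite subrr g0 -[- v]scaleN1r gZ normrN1 mul1r; lra.
exists (\sum_(i < n) g (delta_mx i 0)) => v.
rewrite {1}[v]matrix_sum_delta mulr_suml.
apply: (@le_trans _ _ (\sum_(i < n) g (\sum_j v i j *: delta_mx i j))).
  by elim/big_ind2 : _ => [|x x' y y' hx hy|//];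
    [rewrite g0 | exact: le_trans (gD _ _) (lerD hx hy)].
apply: ler_sum => i _; rewrite big_ord1 gZ mulrC ler_wpM2l//.
rewrite [leRHS]/Num.norm/= mx_normrE; apply/bigmax_geP; right => /=.
by exists (0, i); rewrite //= mxE.
Qed.

(** By [seminorm_le_sup] the norm is Lipschitz for the sup norm, so it attains
    its minimum on the compact sup-norm unit sphere; definiteness makes that
    minimum positive, and homogeneity extends the bound to all vectors. *)
Lemma sup_le_norm N : is_norm N -> exists2 m, 0 < m & forall v, m * `|v^T| <= N v.
Proof.
move=> hN; have [K NK] := seminorm_le_sup (norm_triangle hN) (norm_homogeneous hN).
pose S : set 'rV[R]_n := [set u | `|u| = 1]%classic.
have cN : continuous (fun u : 'rV[R]_n => N u^T).
  move=> u; apply/(@cvgrPdist_le _ _ _ _ (nbhs_filter u)) => e e0.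
  have K0 : 0 < `|K| + 1 by rewrite ltr_wpDl.
  near=> z.
  have zu : `|u - z| <= e / (`|K| + 1).
    near: z; apply: (@cvgr_dist_le _ _ _ _ _ id u (@cvg_id _ (nbhs u))).
    exact: divr_gt0.
  have h : `|N u^T - N z^T| <= N (u - z)^T.
    rewrite ler_norml linearB/=.
    have := norm_triangle hN (u^T - z^T) z^T.
    have := norm_triangle hN (z^T - u^T) u^T.
    rewrite !subrK -(is_normN (z^T - u^T) hN) opprB; lra.
  apply: le_trans h _; apply: le_trans (NK _) _; rewrite trmxK.
  apply: (@le_trans _ _ ((`|K| + 1) * `|u - z|)).
    by rewrite ler_wpM2r//; have := ler_norm K; lra.
  by rewrite mulrC -ler_pdivlMr.
have cS : compact S.
  apply: bounded_closed_compact.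
    by exists 1; split; [exact: real1 | move=> x x1 u /= ->; exact: ltW].
  rewrite (_ : S = (fun u : 'rV[R]_n => `|u|) @^-1` [set 1])%classic//.
  by apply: closed_comp; [move=> u _; exact: norm_continuous | exact: closed_eq].
have [S0|S0] := pselect (S !=set0)%classic; last first.
  (* The sphere is empty only when n = 0, where every vector is 0. *)
  exists 1 => // v; have [->|v0] := eqVneq v^T 0.
    by rewrite normr0 mulr0 is_norm_ge0.
  case: S0; exists (`|v^T|^-1 *: v^T).
  by rewrite /S/= normrZ normfV normr_id mulVf// normr_eq0.
have [u uS umin] := EVT_min_rV S0 cS (continuous_subspaceT cN).
have u1 : `|u| = 1 by move: uS; rewrite inE.
exists (N u^T) => [|v].
  rewrite lt_neqAle is_norm_ge0// andbT eq_sym; apply/eqP => /(norm_definite hN).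
  move/(congr1 trmx); rewrite trmxK trmx0 => u0.
  by move: u1; rewrite u0 normr0 => /eqP; rewrite eq_sym oner_eq0.
have [->|v0] := eqVneq v^T 0; first by rewrite normr0 mulr0 is_norm_ge0.
have vp : 0 < `|v^T| by rewrite normr_gt0.
have : N u^T <= N (`|v^T|^-1 *: v^T)^T.
  by apply: umin; rewrite inE /S/= normrZ normfV normr_id mulVf// gt_eqF.
by rewrite linearZ/= trmxK (norm_homogeneous hN) normfV normr_id mulrC ler_pdivlMr.
Unshelve. all: by end_near.
Qed.

Lemma le_induced_norm N M v : is_norm N -> N (M *m v) <= induced_norm N M * N v.
Proof.
move=> hN.
have [K NK] : exists K, forall v, N (M *m v) <= K * `|v^T|.
  apply: seminorm_le_sup => [u1 u2|a u]; first by rewrite mulmxDr; exact: norm_triangle.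
  by rewrite -scalemxAr; exact: norm_homogeneous.
have [m m0 mN] := sup_le_norm hN.
have bnd : has_ubound [set N (M *m v) | v in [set v | N v <= 1]]%classic.
  exists (`|K| / m) => _ [u /= Nu <-]; apply: le_trans (NK u) _.
  apply: (@le_trans _ _ (`|K| * `|u^T|)); first by rewrite ler_wpM2r// ler_norm.
  by rewrite ler_wpM2l// -[leRHS]mul1r ler_pdivlMr// mulrC (le_trans (mN u)).
have [v0|v0] := eqVneq (N v) 0.
  by rewrite (norm_definite hN v0) mulmx0 is_norm0// mulr0.
have vp : 0 < N v by rewrite lt_neqAle eq_sym v0 is_norm_ge0.
rewrite -ler_pdivrMr// mulrC.
have -> : (N v)^-1 * N (M *m v) = N (M *m ((N v)^-1 *: v)).
  by rewrite -scalemxAr (norm_homogeneous hN) normfV (ger0_norm (ltW vp)).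
apply: ub_le_sup => //=; exists ((N v)^-1 *: v) => //=.
by rewrite (norm_homogeneous hN) normfV (ger0_norm (ltW vp)) mulVf.
Qed.

(** Holds whether or not the supremum is finite, as [sup] is 0 in the latter case. *)
Lemma induced_norm_ge0 N M : is_norm N -> 0 <= induced_norm N M.
Proof.
move=> hN; rewrite /induced_norm; set S := image _ _.
have S0 : S 0 by exists 0; rewrite /= ?mulmx0 is_norm0.
have [hS|/sup_out ->//] := pselect (has_sup S).
by apply: ub_le_sup => //; case: hS.
Qed.
End Norms.

(** * Slow timesteps and their blocks *)

Section Blocks.
Variables (k T : nat).
Hypotheses (k_gt0 : (0 < k)%N) (dvd_kT : (k %| T)%N).

Lemma slowS r : slow k T r.+1 = (r < T)%N && (k %| r)%N.
Proof. by rewrite /slow/= -addn1 -[X in _ == X %[mod _]]add0n eqn_modDr mod0n. Qed.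

Lemma slow_block_range r t :
  slow k T r -> (r <= t < r + k)%N -> (1 <= t <= T)%N.
Proof.
case: r => // r; rewrite slowS => /andP[rT /dvdnP[p rE]] /andP[rt trk].
have : (r + k <= T)%N.
  case/dvdnP: dvd_kT rT => q ->; rewrite rE ltn_mul2r k_gt0/= => pq.
  by rewrite addnC -mulSn leq_mul2r pq orbT.
lia.
Qed.

Lemma slow_blockP t : (1 <= t <= T)%N ->
  exists2 r, slow k T r & (r <= t < r + k)%N.
Proof.
clear dvd_kT; case: t => // t /andP[_ tT]; exists (t %/ k * k).+1.
  rewrite slowS dvdn_mull// andbT.
  exact: leq_ltn_trans (leq_trunc_div _ _) tT.
have := ltn_pmod t k_gt0; have := divn_eq t k; lia.
Qed.

Lemma sum_slow (V : nmodType) (G : nat -> V) :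
  \sum_(1 <= r < T.+1 | slow k T r) G r
    = \sum_(0 <= i < T %/ k) G (i * k).+1.
Proof.
rewrite big_add1/= big_mkcond/= -{1}(divnK dvd_kT) big_nat_mul.
apply: eq_big_nat => i /andP[_ iq].
have ikT : (i.+1 * k <= T)%N by rewrite -leq_divRL.
rewrite big_ltn; last by rewrite mulSn; lia.
rewrite big_nat big1 => [|j /andP[ij ji]].
  by rewrite /= addr0 slowS dvdn_mull// andbT ifT//; rewrite mulSn in ikT; lia.
rewrite slowS ifF// andbC; apply/negbTE; rewrite negb_and.
rewrite -(subnKC (ltnW ij)) /dvdn modnMDl modn_small ?subn_eq0 -?ltnNge ?ij//.
by rewrite mulSn in ji; lia.
Qed.

(** The blocks starting at the slow timesteps tile {1, ..., T}; divisibility of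
    [T] by [k] is what makes the last block end exactly at [T]. *)
Lemma sum_slow_block (V : nmodType) (F : nat -> V) :
  \sum_(1 <= r < T.+1 | slow k T r) \sum_(r <= t < r + k) F t
    = \sum_(1 <= t < T.+1) F t.
Proof.
rewrite sum_slow big_add1/= -{2}(divnK dvd_kT) big_nat_mul.
by apply: eq_bigr => i _; rewrite addSn big_add1/= mulSn addnC.
Qed.
End Blocks.

(** * Cost of the algorithm against an arbitrary trajectory *)

Section Analysis.
Variables (R : realType) (n : nat) (Nx Nf Ns : 'cV[R]_n -> R).
Hypotheses (hNx : is_norm Nx) (hNf : is_norm Nf) (hNs : is_norm Ns).
Variables (A Bf Bs : 'M[R]_n) (k T : nat).
Hypotheses (hBf : Bf \in unitmx) (k_gt0 : (0 < k)%N) (dvd_kT : (k %| T)%N).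
Implicit Types w x f s y g u : nat -> 'cV[R]_n.

Let beta := induced_norm Nf (invmx Bf).

(** The fast action cancels the slow action and the disturbance, leaving
    [x t = A *m x t.-1]. *)
Lemma MRPC_state0 w w' x f s : MRPC_run Nf Ns A Bf Bs k T w w' x f s ->
  forall t, (t <= T)%N -> x t = 0.
Proof.
case=> _ fE [x0 xE]; elim=> [//|t IH tT].
have [r rs rt] := slow_blockP k_gt0 (t := t.+1) tT.
rewrite (xE r _ rs rt) (fE r _ rs rt) IH ?(ltnW tT)//= mulmx0 add0r.
by rewrite mulmxN mulmxA mulmxV// mul1mx -addrA addNr.
Qed.

Lemma MRPC_cost w w' x f s : MRPC_run Nf Ns A Bf Bs k T w w' x f s ->
  cost Nx Nf Ns k T x f s
    = \sum_(1 <= r < T.+1 | slow k T r) slow_objective Nf Ns Bf Bs k w r (s r).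
Proof.
move=> run; have x0 := MRPC_state0 run; case: run => _ fE _.
apply: eq_bigr => r rs; congr (_ + _); apply: eq_big_nat => t rt.
rewrite x0; last by case/andP: (slow_block_range k_gt0 dvd_kT rs rt).
by rewrite (fE r)// is_norm0// add0r is_normN.
Qed.

Lemma slow_objective_lipschitz w w' r v :
  slow_objective Nf Ns Bf Bs k w r v
    <= slow_objective Nf Ns Bf Bs k w' r v
       + beta * \sum_(r <= t < r + k) Nf (w' t - w t).
Proof.
rewrite /slow_objective -addrA lerD2l mulr_sumr -big_split/=.
apply: ler_sum => t _.
have -> : Bs *m v + w t = (Bs *m v + w' t) - (w' t - w t).
  by rewrite opprB [w t - _]addrC addrA addrK.
rewrite mulmxBr; apply: le_trans (is_normB _ _ hNf) _.
by rewrite lerD2l le_induced_norm.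
Qed.

(** Each block pays for the prediction error twice: once to replace [w] by [w']
    at the action played, once to go back to [w] at the comparison action. *)
Lemma slow_regret w w' x f s : MRPC_run Nf Ns A Bf Bs k T w w' x f s ->
  forall u,
  \sum_(1 <= r < T.+1 | slow k T r) slow_objective Nf Ns Bf Bs k w r (s r)
    <= \sum_(1 <= r < T.+1 | slow k T r) slow_objective Nf Ns Bf Bs k w r (u r)
       + 2 * beta * \sum_(1 <= t < T.+1) Nf (w' t - w t).
Proof.
move=> [smin _ _] u.
rewrite -(sum_slow_block k_gt0 dvd_kT) mulr_sumr -big_split/=.
apply: ler_sum => r rs.
have h1 := slow_objective_lipschitz w w' r (s r).
have h2 := smin r rs (u r).
have h3 := slow_objective_lipschitz w' w r (u r).
have e : \sum_(r <= t < r + k) Nf (w t - w' t) = \sum_(r <= t < r + k) Nf (w' t - w t).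
  by apply: eq_bigr => t _; rewrite -is_normN// opprB.
rewrite e in h3; lra.
Qed.

(** Keeping the state at 0 with the slow actions of a feasible trajectory is
    competitive: a trajectory that lets disturbances enter the state pays for it
    in state cost, at rate [c / (b (1 + a))] of the fast action needed to cancel
    them. *)
Lemma reflexive_le_feasible c w y g u :
  0 < c -> (forall v, c * Nf v <= Nx v) ->
  feasible A Bf Bs k T w y g u ->
  \sum_(1 <= r < T.+1 | slow k T r) slow_objective Nf Ns Bf Bs k w r (u r)
    <= Num.max ((1 + induced_norm Nx A) * beta / c) 1 * cost Nx Nf Ns k T y g u.
Proof.
move=> c0 cN [y0 yE].
set alpha := induced_norm Nx A; set C := Num.max _ _.
have a0 : 0 <= alpha by exact: induced_norm_ge0.
have b0 : 0 <= beta by exact: induced_norm_ge0.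
have C1 : 1 <= C by rewrite le_max lexx orbT.
have Crho : (1 + alpha) * beta / c <= C by rewrite le_max lexx.
have step r t : slow k T r -> (r <= t < r + k)%N ->
    Nf (invmx Bf *m (Bs *m u r + w t))
      <= Nf (g t) + beta / c * (Nx (y t) + alpha * Nx (y t.-1)).
  move=> rs rt.
  have -> : Bs *m u r + w t = (y t - A *m y t.-1) - Bf *m g t.
    apply: (addIr (Bf *m g t)); rewrite subrK; apply: (addIr (A *m y t.-1)).
    by rewrite subrK (yE r t rs rt) addrC [_ + w t + _]addrC !addrA.
  rewrite mulmxBr mulmxA mulVmx// mul1mx.
  apply: le_trans (is_normB _ _ hNf) _; rewrite addrC lerD2l.
  apply: le_trans (le_induced_norm _ _ hNf) _; rewrite -mulrA ler_wpM2l//.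
  rewrite mulrC ler_pdivlMr// mulrC; apply: le_trans (cN _) _.
  by apply: le_trans (is_normB _ _ hNx) _; rewrite lerD2l le_induced_norm.
(* Here the initial condition [y 0 = 0] enters. *)
have shift : \sum_(1 <= t < T.+1) Nx (y t.-1) <= \sum_(1 <= t < T.+1) Nx (y t).
  rewrite [leLHS]big_add1/=; case: (T) => [|m]; first by rewrite !big_geq.
  rewrite big_nat_recl// y0 is_norm0// add0r [leRHS]big_add1/= big_nat_recr//=.
  by rewrite lerDl is_norm_ge0.
rewrite /slow_objective /cost !big_split/=.
apply: (@le_trans _ _ (\sum_(1 <= r < T.+1 | slow k T r) k%:R * Ns (u r)
   + \sum_(1 <= t < T.+1) (Nf (g t) + beta / c * (Nx (y t) + alpha * Nx (y t.-1))))).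
  rewrite lerD2l -(sum_slow_block k_gt0 dvd_kT).
  by apply: ler_sum => r rs; apply: ler_sum_nat => t rt; exact: step.
rewrite (sum_slow_block k_gt0 dvd_kT) !big_split/= -!mulr_sumr big_split/= -mulr_sumr.
set SN := \sum_(1 <= r < T.+1 | slow k T r) Ns (u r).
set SX := \sum_(1 <= t < T.+1) Nx (y t) in shift *.
set SX' := \sum_(1 <= t < T.+1) Nx (y t.-1) in shift *.
set SF := \sum_(1 <= t < T.+1) Nf (g t).
have SN0 : 0 <= k%:R * SN by rewrite mulr_ge0// sumr_ge0// => *; exact: is_norm_ge0.
have SX0 : 0 <= SX by apply: sumr_ge0 => *; exact: is_norm_ge0.
have SF0 : 0 <= SF by apply: sumr_ge0 => *; exact: is_norm_ge0.
have hX : beta / c * (SX + alpha * SX') <= C * SX.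
  apply: (@le_trans _ _ ((1 + alpha) * beta / c * SX)); last exact: ler_wpM2r.
  have -> : (1 + alpha) * beta / c * SX = beta / c * (SX + alpha * SX) by ring.
  by rewrite ler_wpM2l ?divr_ge0 ?(ltW c0)// lerD2l ler_wpM2l.
have hS := ler_wpM2r SN0 C1; have hF := ler_wpM2r SF0 C1.
rewrite !mul1r in hS hF; rewrite !mulrDr; lra.
Qed.

End Analysis.

Theorem theorem2 (R : realType) (n : nat) (Nx Nf Ns : 'cV[R]_n -> R)
    (hNx : is_norm Nx) (hNf : is_norm Nf) (hNs : is_norm Ns)
    (A Bf Bs : 'M[R]_n) (hBf : Bf \in unitmx)
    (k T : nat) (hk : (1 <= k)%N) (hT : (1 <= T)%N) (hkT : (k %| T)%N)
    (c : R) (hc : 0 < c) (hcN : forall v : 'cV[R]_n, c * Nf v <= Nx v)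
    (w w' : nat -> 'cV[R]_n)
    (x f s : nat -> 'cV[R]_n) (hrun : MRPC_run Nf Ns A Bf Bs k T w w' x f s) :
  cost Nx Nf Ns k T x f s / T%:R
    <= Num.max ((1 + induced_norm Nx A) * induced_norm Nf (invmx Bf) / c) 1
         * (OPT Nx Nf Ns A Bf Bs k T w / T%:R)
       + 2 * induced_norm Nf (invmx Bf) * prediction_error Nf T w' w.
Proof.
rewrite /prediction_error mulrA mulrCA -mulrA mulrA [T%:R^-1 * _]mulrC -mulrDl.
set C := Num.max _ _; set D := 2 * _ * _.
have T0 : 0 < T%:R^-1 :> R by rewrite invr_gt0 ltr0n.
rewrite ler_pM2r//.
have C0 : 0 < C by rewrite lt_max ltr01 orbT.
rewrite -lerBlDr mulrC -ler_pdivrMr//.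
(* [OPT] is an infimum: it suffices to bound the cost of each feasible trajectory. *)
apply: lb_le_inf.
  by exists (cost Nx Nf Ns k T x f s), x, f, s; case: hrun.
move=> _ [y [g [u [yfeas ->]]]]; rewrite ler_pdivrMr// mulrC lerBlDr.
rewrite (MRPC_cost hNx hNf hBf hk hkT hrun).
apply: le_trans (slow_regret hNf hk hkT hrun u) _.
by rewrite lerD2r (reflexive_le_feasible hNx hNf hNs hBf hk hkT hc hcN yfeas).
Qed.
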